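(* Let $N\ge 3$, let $\mathbf d\in\mathbb R^N$, and let $\lambda\in\mathbb R$ be such that $\mathbf I_N+\lambda\mathbf D^\top\mathbf D$ is positive definite. Let $\mathbf C\in\mathbb R^{N\times N}$ be any invertible matrix satisfying $\mathbf D\mathbf C=\mathbf J$, and let $$\boldsymbol\xi^{\mathbf C}_{\mathrm{opt}}(\lambda)=\arg\min_{\boldsymbol\xi\in\mathbb R^N}\tilde f^{\mathbf C}_\lambda(\boldsymbol\xi),\qquad \tilde f^{\mathbf C}_\lambda(\boldsymbol\xi)=\|\mathbf d-\mathbf C\boldsymbol\xi\|_2^2+\lambda\|\mathbf J\boldsymbol\xi\|_2^2 .$$ Then $\mathbf C\,\boldsymbol\xi^{\mathbf C}_{\mathrm{opt}}(\lambda)=\mathbf x_{\mathrm{opt}}(\lambda)$ for every such $\mathbf C$. In particular, the matrices $\mathbf A$ and $\mathbf B$ (the A- and B-representations) give the same trend: $$\mathbf A\,\boldsymbol\xi^{\mathbf A}_{\mathrm{opt}}(\lambda)=\mathbf B\,\boldsymbol\xi^{\mathbf B}_{\mathrm{opt}}(\lambda)=\mathbf x_{\mathrm{opt}}(\lambda).$$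
   Context: $\mathbf D\in\mathbb R^{(N-2)\times N}$ is the second-difference matrix, $(\mathbf D\mathbf x)_i=x_i-2x_{i+1}+x_{i+2}$ for $i=1,\dots,N-2$. It has rank $N-2$ and kernel equal to the column space of $\mathbf\Pi=\big(\mathbf 1_N\mid(1,2,\dots,N)^\top\big)\in\mathbb R^{N\times 2}$. $\mathbf J=(\mathbf 0_{(N-2)\times 2}\mid\mathbf I_{N-2})\in\mathbb R^{(N-2)\times N}$. The Hodrick--Prescott trend is the unique minimizer $\mathbf x_{\mathrm{opt}}(\lambda)=\arg\min_{\mathbf x\in\mathbb R^N}\{\|\mathbf d-\mathbf x\|_2^2+\lambda\|\mathbf D\mathbf x\|_2^2\}=(\mathbf I_N+\lambda\mathbf D^\top\mathbf D)^{-1}\mathbf d$. Let $\mathbf F=\mathbf D^\top(\mathbf D\mathbf D^\top)^{-1}$ be the Moore--Penrose pseudoinverse of $\mathbf D$, and let $\mathbf S=\mathbf F+\mathbf\Pi\mathbf M$ with $\mathbf M\in\mathbb R^{2\times(N-2)}$ arbitrary, so that $\mathbf D\mathbf F=\mathbf D\mathbf S=\mathbf I_{N-2}$. The A-representation is $\mathbf A=(\mathbf\Pi\mid\mathbf S)\in\mathbb R^{N\times N}$ and the B-representation is $\mathbf B=(\mathbf\Pi\mid\mathbf F)\in\mathbb R^{N\times N}$; both satisfy $\mathbf D\mathbf A=\mathbf D\mathbf B=\mathbf J$. *)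

(* Defs.v *)
From mathcomp Require Import all_boot all_order all_algebra.
From mathcomp Require Import classical_sets reals.

Set Implicit Arguments.
Unset Strict Implicit.
Unset Printing Implicit Defensive.

Import Order.TTheory GRing.Theory Num.Theory.

Local Open Scope ring_scope.

Definition norm2 (R : realType) (m : nat) (x : 'cV[R]_m) : R :=
  Num.sqrt (\sum_i x i 0 ^+ 2).

Definition posdef (R : realType) (m : nat) (P : 'M[R]_m) : Prop :=
  P^T = P /\ forall x : 'cV[R]_m, x != 0 -> 0 < (x^T *m P *m x) 0 0.

Definition is_minimizer (R : realType) (m : nat) (f : 'cV[R]_m -> R)
    (x : 'cV[R]_m) : Prop :=
  forall y : 'cV[R]_m, f x <= f y.

(* The value is chosen among the minimizers, and is 0 if there are none: it is
   meaningful as "the" minimizer only together with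
   [unique (is_minimizer f) (argmin f)]. *)
Definition argmin (R : realType) (m : nat) (f : 'cV[R]_m -> R) : 'cV[R]_m :=
  xget 0 [set x | is_minimizer f x]%classic.

(* Throughout, N = 2 + n, so that N - 2 = n and the block matrices below have
   their natural dimensions. Indices start at 0. *)

Definition Dmx (R : realType) (n : nat) : 'M[R]_(n, 2 + n) :=
  \matrix_(i, j) ((j == i :> nat)%:R - 2 * (j == i.+1 :> nat)%:R
                  + (j == i.+2 :> nat)%:R).

Definition Jmx (R : realType) (n : nat) : 'M[R]_(n, 2 + n) :=
  row_mx (0 : 'M_(n, 2)) (1%:M : 'M_n).

Definition Pimx (R : realType) (n : nat) : 'M[R]_(2 + n, 2) :=
  row_mx (const_mx 1 : 'cV_(2 + n)) (\col_(i < 2 + n) (i.+1)%:R).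

(* [Dmx R n] has full row rank, so [Dmx R n *m (Dmx R n)^T] is invertible and
   [invmx] is its true inverse. *)
Definition Fmx (R : realType) (n : nat) : 'M[R]_(2 + n, n) :=
  (Dmx R n)^T *m invmx (Dmx R n *m (Dmx R n)^T).

Definition Smx (R : realType) (n : nat) (M : 'M[R]_(2, n)) : 'M[R]_(2 + n, n) :=
  Fmx R n + Pimx R n *m M.

Definition Amx (R : realType) (n : nat) (M : 'M[R]_(2, n)) : 'M[R]_(2 + n) :=
  row_mx (Pimx R n) (Smx M).

Definition Bmx (R : realType) (n : nat) : 'M[R]_(2 + n) :=
  row_mx (Pimx R n) (Fmx R n).

Definition hp_matrix (R : realType) (n : nat) (lam : R) : 'M[R]_(2 + n) :=
  1%:M + lam *: ((Dmx R n)^T *m Dmx R n).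

Definition hp_obj (R : realType) (n : nat) (d : 'cV[R]_(2 + n)) (lam : R)
    (x : 'cV[R]_(2 + n)) : R :=
  norm2 (d - x) ^+ 2 + lam * norm2 (Dmx R n *m x) ^+ 2.

Definition x_opt (R : realType) (n : nat) (d : 'cV[R]_(2 + n)) (lam : R) :
    'cV[R]_(2 + n) :=
  argmin (hp_obj d lam).

Definition ftilde (R : realType) (n : nat) (d : 'cV[R]_(2 + n)) (lam : R)
    (C : 'M[R]_(2 + n)) (xi : 'cV[R]_(2 + n)) : R :=
  norm2 (d - C *m xi) ^+ 2 + lam * norm2 (Jmx R n *m xi) ^+ 2.

Definition xi_opt (R : realType) (n : nat) (d : 'cV[R]_(2 + n)) (lam : R)
    (C : 'M[R]_(2 + n)) : 'cV[R]_(2 + n) :=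
  argmin (ftilde d lam C).

(* Main.v *)
(* For invertible C with D C = J, the reparametrized objective is the
   Hodrick-Prescott objective composed with the bijection C, so C transports its
   unique minimizer to the trend. Completing the square around the solution of
   (I + lam D^T D) x = d shows that the trend exists and is unique. The matrices
   A and B are admissible because D Pi = 0 and D F = I. *)
Require Import Defs.
From mathcomp Require Import all_boot all_order all_algebra.
From mathcomp Require Import boolp classical_sets reals.
From mathcomp Require Import zify ring lra.

Set Implicit Arguments.
Unset Strict Implicit.
Unset Printing Implicit Defensive.

Import Order.TTheory GRing.Theory Num.Theory.

Local Open Scope ring_scope.

Lemma unitmx_trivial_kernel (F : fieldType) (m : nat) (P : 'M[F]_m) :
  (forall v : 'cV[F]_m, P *m v = 0 -> v = 0) -> P \in unitmx.
Proof.
move=> kerP; rewrite -unitmx_tr -row_free_unit; apply: inj_row_free => v vP0.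
by apply: trmx_inj; rewrite trmx0; apply: kerP;
  rewrite -[LHS]trmxK trmx_mul trmxK vP0 trmx0.
Qed.

(* Unlike [mxE], these leave the entries of matrix products folded. *)
Lemma mxentryE (V : pzRingType) (m p : nat) (i : 'I_m) (j : 'I_p) :
  ((forall A B : 'M[V]_(m, p), ((A + B) i j = A i j + B i j)%R)
  * (forall A : 'M[V]_(m, p), ((- A) i j = - A i j)%R)
  * (forall c (A : 'M[V]_(m, p)), ((c *: A) i j = c * A i j)%R))%type.
Proof. by do !split=> *; rewrite mxE. Qed.

Section QuadraticMinimization.
Context {R : realType} {m : nat}.
Implicit Types (f : 'cV[R]_m -> R) (x y : 'cV[R]_m) (P C : 'M[R]_m).

Lemma norm2_sqr x : norm2 x ^+ 2 = (x^T *m x) 0 0.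
Proof.
rewrite sqr_sqrtr ?sumr_ge0 // => [|i _]; last exact: sqr_ge0.
by rewrite mxE; apply: eq_bigr => i _; rewrite mxE.
Qed.

Lemma dotmx_eq0 x : (x^T *m x) 0 0 = 0 -> x = 0.
Proof.
rewrite mxE => /eqP; rewrite psumr_eq0 => [/allP x0|i _]; last first.
  by rewrite mxE -expr2 sqr_ge0.
apply/colP => i; have := x0 i (mem_index_enum i).
by rewrite !mxE -expr2 sqrf_eq0 => /eqP.
Qed.

Lemma posdef_unitmx P : posdef P -> P \in unitmx.
Proof.
move=> [_ P_gt0]; apply: unitmx_trivial_kernel => v Pv0.
apply/eqP; case: eqVneq => // /P_gt0.
by rewrite -mulmxA Pv0 mulmx0 mxE ltxx.
Qed.

Lemma unique_minimizer_quadratic f P x0 : posdef P ->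
  (forall x, f x = f x0 + ((x - x0)^T *m P *m (x - x0)) 0 0) ->
  unique (is_minimizer f) x0.
Proof.
move=> [_ P_gt0] fE; split=> [y|y min_y].
  rewrite (fE y) lerDl; have [->|/P_gt0/ltW//] := eqVneq (y - x0) 0.
  by rewrite mulmx0 mxE.
apply/esym/eqP; rewrite -subr_eq0; case: eqVneq => // /P_gt0.
(* Comparing [y] with [x0] forces the form at [y - x0] to be nonpositive, against positive
   definiteness. *)
by have := min_y x0; rewrite (fE y) gerDl leNgt => /negP.
Qed.

(** Existence of [x0] rules out the default value [0] of [argmin]; uniqueness then identifies the
    chosen point. *)
Lemma argmin_unique f x0 : unique (is_minimizer f) x0 -> argmin f = x0.
Proof.
by move=> [min_x0 uniq_x0]; rewrite /argmin;
  case: xgetP => [x -> /uniq_x0 //|/(_ x0)].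
Qed.

Lemma unique_minimizer_comp f C x0 : C \in unitmx ->
  unique (is_minimizer f) x0 ->
  unique (is_minimizer (fun y => f (C *m y))) (invmx C *m x0).
Proof.
move=> uC [min_x0 uniq_x0]; split=> [y|y min_y]; first by rewrite mulKVmx.
rewrite (uniq_x0 (C *m y)) ?mulKmx // => z.
by have := min_y (invmx C *m z); rewrite mulKVmx.
Qed.

End QuadraticMinimization.

Section SecondDifference.
Context {R : realType} {n : nat}.
Local Notation D := (Dmx R n).
Local Notation Pi := (Pimx R n).

Lemma sum_delta_nat (m k : nat) (km : (k < m)%N) (f : 'I_m -> R) :
  \sum_(j < m) (j == k :> nat)%:R * f j = f (Ordinal km).
Proof.
rewrite (bigD1 (Ordinal km)) //= eqxx mul1r big1 ?addr0 // => j.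
by rewrite -val_eqE /= => /negbTE ->; rewrite mul0r.
Qed.

(** Giving the column as a function on [nat] lets the shifts [i.+1] and [i.+2] be written without
    bound proofs. *)
Lemma mul_DmxE p (X : 'M[R]_(2 + n, p)) (f : nat -> R) i j :
  (forall k : 'I_(2 + n), X k j = f k) ->
  (D *m X) i j = f i - 2 * f i.+1 + f i.+2.
Proof.
move=> Xf; have lt_in := ltn_ord i.
have lt0 : (i < 2 + n)%N by rewrite ltnW // ltnW.
have lt1 : (i.+1 < 2 + n)%N by rewrite ltnW.
have lt2 : (i.+2 < 2 + n)%N by [].
rewrite mxE; under eq_bigr => k _ do
  rewrite mxE Xf mulrDl mulrBl -mulrA.
rewrite big_split sumrB -mulr_sumr /=.
by rewrite (sum_delta_nat lt0) (sum_delta_nat lt1) (sum_delta_nat lt2).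
Qed.

Lemma mul_Dmx_Pimx : D *m Pi = 0.
Proof.
apply/matrixP => i j.
(* Both columns of [Pi] are affine in the row index; the second is [k.+1] because rows are counted
   from 0. *)
rewrite (mul_DmxE (f := fun k => if j == 0 then 1 else k.+1%:R)) => [|k].
  by rewrite mxE; case: ifP => _; rewrite -?natr1; ring.
by rewrite mxE; case: splitP => l jl; rewrite mxE -val_eqE /= jl ?ord1.
Qed.

(* The last [n] columns of [D] form a lower unitriangular matrix. *)
Lemma row_free_Dmx : row_free D.
Proof.
have uD : rsubmx D \in unitmx.
  rewrite unitmxE det_trig; last first.
    (* Column [j] of the block is column [j + 2] of [D], which lies beyond the last nonzero entry
       [i + 2] of row [i] when [i < j]. *)
    apply/is_trig_mxP => i j ij; rewrite !mxE /=.
    by rewrite !gtn_eqF ?mulr0 ?subr0 ?addr0 //=; lia.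
  rewrite big1 ?unitr1 // => i _; rewrite !mxE /=.
  by rewrite !add2n eqxx !gtn_eqF ?mulr0 ?subr0 ?add0r //=; lia.
apply: inj_row_free => v vD0; apply: (can_inj (mulmxK uD)).
by rewrite mulmx_rsub vD0 linear0 mul0mx.
Qed.

(** If [D *m D^T *m v = 0], then the squared norm of [D^T *m v] vanishes, and full row rank of [D]
    gives [v = 0]. *)
Lemma Dmx_gram_unitmx : D *m D^T \in unitmx.
Proof.
apply: unitmx_trivial_kernel => v DDv0.
have Dv0 : D^T *m v = 0.
  by apply: dotmx_eq0; rewrite trmx_mul trmxK -mulmxA (mulmxA D) DDv0 mulmx0 mxE.
apply: trmx_inj; apply: (row_free_inj row_free_Dmx).
by rewrite trmx0 mul0mx -[D in LHS]trmxK -trmx_mul Dv0 trmx0.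
Qed.

Lemma mul_Dmx_Amx (M : 'M[R]_(2, n)) : D *m Amx M = Jmx R n.
Proof.
rewrite /Amx /Smx mul_mx_row mul_Dmx_Pimx mulmxDr mulmxA mul_Dmx_Pimx.
by rewrite mul0mx addr0 /Fmx mulmxA mulmxV // Dmx_gram_unitmx.
Qed.

(** The first two rows of [Pi], (1, 1) and (1, 2), already determine [w]. *)
Lemma Pimx_ker (w : 'cV[R]_2) : Pi *m w = 0 -> w = 0.
Proof.
move=> /colP Piw; have := Piw (lshift n 0); have := Piw (lshift n 1).
rewrite !mxE !big_ord_recl !big_ord0 !mxE.
case: splitP => j; rewrite ?ord1 //= => _.
case: splitP => k; rewrite ?ord1 //= => _.
rewrite !mxE /= modn_small // => e1 e0.
have w1 : w (lift ord0 0) 0 = 0 by lra.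
have w0 : w ord0 0 = 0 by lra.
by apply/colP => i; rewrite mxE; case: (unliftP ord0 i) => [l|] ->; rewrite ?ord1.
Qed.

(** Applying [D] to a kernel vector kills its last [n] entries; the first two then lie in the kernel
    of [Pi]. *)
Lemma Amx_unitmx (M : 'M[R]_(2, n)) : Amx M \in unitmx.
Proof.
apply: unitmx_trivial_kernel => w Aw0.
have : Jmx R n *m w = 0 by rewrite -(mul_Dmx_Amx M) -mulmxA Aw0 mulmx0.
rewrite /Jmx -[w]vsubmxK mul_row_col mul0mx mul1mx add0r => w2.
move: Aw0; rewrite /Amx -[w]vsubmxK mul_row_col w2 mulmx0 addr0 => /Pimx_ker ->.
by rewrite vsubmxK col_mx0.
Qed.

Lemma Bmx_Amx : Bmx R n = Amx 0.
Proof. by rewrite /Amx /Smx mulmx0 addr0. Qed.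

End SecondDifference.

Section HodrickPrescott.
Context {R : realType} {n : nat}.
Variables (d : 'cV[R]_(2 + n)) (lam : R).
Hypothesis hlam : posdef (hp_matrix n lam).
Local Notation P := (hp_matrix n lam).

(** Both cross terms are kept, so that the expansion needs no symmetry of the scalar product. *)
Lemma hp_objE x :
  hp_obj d lam x = (d^T *m d - d^T *m x - x^T *m d + x^T *m P *m x) 0 0.
Proof.
rewrite /hp_obj !norm2_sqr /hp_matrix trmx_mul mulmxDr mulmx1 mulmxDl.
rewrite -scalemxAr -scalemxAl !linearB /= !mulmxBl !mulmxA !mxentryE.
by ring.
Qed.

Lemma hp_obj_complete_square x x0 : P *m x0 = d ->
  hp_obj d lam x = hp_obj d lam x0 + ((x - x0)^T *m P *m (x - x0)) 0 0.
Proof.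
move=> Px0; have x0P : x0^T *m P = d^T by rewrite -Px0 trmx_mul hlam.1.
(* Both sides equal [x0^T *m P *m x0]. *)
have dx0 : x0^T *m d = d^T *m x0 by rewrite -x0P -mulmxA Px0.
rewrite !hp_objE !linearB /= !mulmxBl x0P -!mulmxA Px0 !mxentryE dx0.
by ring.
Qed.

Lemma hp_obj_unique_minimizer :
  unique (is_minimizer (hp_obj d lam)) (invmx P *m d).
Proof.
apply: (unique_minimizer_quadratic hlam) => x; apply: hp_obj_complete_square.
by rewrite mulKVmx // posdef_unitmx.
Qed.

Lemma x_optE : x_opt d lam = invmx P *m d.
Proof. exact: argmin_unique hp_obj_unique_minimizer. Qed.

Lemma xi_opt_trend (C : 'M[R]_(2 + n)) :
  C \in unitmx -> Dmx R n *m C = Jmx R n ->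
  unique (is_minimizer (ftilde d lam C)) (xi_opt d lam C)
  /\ C *m xi_opt d lam C = x_opt d lam.
Proof.
move=> uC DC; have min_xi := unique_minimizer_comp uC hp_obj_unique_minimizer.
(* [D *m C = J] turns the penalty on [xi] into the penalty on [C *m xi]. *)
have ftildeE : ftilde d lam C = fun xi => hp_obj d lam (C *m xi).
  by apply/funext => xi; rewrite /ftilde /hp_obj mulmxA DC.
rewrite -ftildeE in min_xi.
by rewrite /xi_opt (argmin_unique min_xi) x_optE mulKVmx.
Qed.

End HodrickPrescott.

Theorem proposition1 (R : realType) (n : nat) (hN : (3 <= 2 + n)%N)
    (d : 'cV[R]_(2 + n)) (lam : R) (hlam : posdef (hp_matrix n lam)) :
  [/\ unique (is_minimizer (hp_obj d lam)) (x_opt d lam)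
        /\ x_opt d lam = invmx (hp_matrix n lam) *m d,
      forall C : 'M[R]_(2 + n), C \in unitmx -> Dmx R n *m C = Jmx R n ->
        unique (is_minimizer (ftilde d lam C)) (xi_opt d lam C)
        /\ C *m xi_opt d lam C = x_opt d lam
    & forall M : 'M[R]_(2, n),
        [/\ unique (is_minimizer (ftilde d lam (Amx M)))
              (xi_opt d lam (Amx M)),
            unique (is_minimizer (ftilde d lam (Bmx R n)))
              (xi_opt d lam (Bmx R n)),
            Amx M *m xi_opt d lam (Amx M) =
              Bmx R n *m xi_opt d lam (Bmx R n)
          & Bmx R n *m xi_opt d lam (Bmx R n) = x_opt d lam]].
Proof.
have minA M := xi_opt_trend d hlam (Amx_unitmx M) (mul_Dmx_Amx M).
split; first by rewrite x_optE //; split=> //; exact: hp_obj_unique_minimizer.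
  exact: xi_opt_trend.
move=> M; rewrite Bmx_Amx; have [uA tA] := minA M; have [uB tB] := minA 0.
by split=> //; rewrite tA tB.
Qed.
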